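(* Let $(X,d,p)$ be a metric space with a marked point $p$. Suppose that $X$ is midpoint convex at $p$ and that $$\liminf_{w,x,y,z\to p}A_{2}(w,x,y,z)\ge 0,$$ where $A_2:X^4\to\mathbb R$ is defined by $$A_{2}(w,x,y,z):= \frac{d^{2}(w,x)+d^{2}(w,y)+d^{2}(w,z)-\frac{1}{3}\bigl(d^{2}(x,y)+d^{2}(y,z)+d^{2}(z,x)\bigr)}{\bigl(\max\{d(w,p),d(x,p),d(y,p),d(z,p)\}\bigr)^{2}}$$ for $(w,x,y,z)\neq(p,p,p,p)$ and $A_2(p,p,p,p):=0$. Then every separable tangent space $\Omega_{p,\tilde r}^{X}$ to $X$ at $p$ (for any normalizing sequence $\tilde r$) is a space of nonnegative curvature in the sense of Aleksandrov.
   Context: Pretangent and tangent spaces. Let $(X,d,p)$ be a metric space with marked point $p$. A normalizing sequence is a sequence $\tilde r=\{r_n\}_{n\in\mathbb N}$ of positive reals with $r_n\to 0$. Let $\tilde X$ be the set of all sequences of points of $X$. Two sequences $\tilde x=\{x_n\},\tilde y=\{y_n\}\in\tilde X$ are mutually stable with respect to $\tilde r$ if the finite limit $\tilde d_{\tilde r}(\tilde x,\tilde y):=\lim_{n\to\infty} d(x_n,y_n)/r_n$ exists. A family $\tilde F\subseteq\tilde X$ is self-stable if any two of its elements are mutually stable; it is maximal self-stable if moreover for every $\tilde z\in\tilde X\setminus\tilde F$ there is $\tilde x\in\tilde F$ such that $\tilde x,\tilde z$ are not mutually stable. Let $\tilde X_{p,\tilde r}$ denote a maximal self-stable family (with respect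 to $\tilde r$) containing the constant sequence $\tilde p=(p,p,\dots)$. Then $(\tilde X_{p,\tilde r},\tilde d_{\tilde r})$ is a pseudometric space; the metric space $(\Omega_{p,\tilde r}^{X},\rho)$ obtained from it by identifying $\tilde x,\tilde y$ whenever $\tilde d_{\tilde r}(\tilde x,\tilde y)=0$, with $\rho$ induced by $\tilde d_{\tilde r}$, is called a pretangent space to $X$ at $p$ with respect to $\tilde r$. (There may be several pretangent spaces for one $\tilde r$, depending on the choice of $\tilde X_{p,\tilde r}$.) For a strictly increasing sequence $\{n_k\}$ of natural numbers put $\tilde r'=\{r_{n_k}\}_{k}$ and $\tilde x'=\{x_{n_k}\}_k$ for $\tilde x\in\tilde X$. For every maximal self-stable (with respect to $\tilde r'$) family $\tilde X_{p,\tilde r'}\supseteq\{\tilde x':\tilde x\in\tilde X_{p,\tilde r}\}$ the map $\tilde x\mapsto\tilde x'$ induces an isometric embedding $em':\Omega_{p,\tilde r}^{X}\to\Omega_{p,\tilde r'}^{X}$. The pretangent space $\Omega_{p,\tilde r}^{X}$ is called tangent if $em'$ is bijective for every such $\{n_k\}$ and every such $\tilde X_{p,\tilde r'}$. Midpoint convexity at $p$. $X$ is midpoint convex at $p$ if for any two sequences $\tilde x=\{x_n\}$, $\tilde y=\{y_n\}$ in $X$ converging to $p$ there is a sequence $\tilde z=\{z_n\}$ in $X$ (called an infinitesimal midpoint of $\tilde x,\tilde y$) such that, with $\delta_p(x,y):=\max\{d(x,p),d(y,p)\}$, $$\lim_{n\to\infty}\frac{|d(x_n,z_n)-\frac12 d(x_n,y_n)|}{\delta_p(x_n,y_n)}=\lim_{n\to\infty}\frac{|d(y_n,z_n)-\frac12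 d(x_n,y_n)|}{\delta_p(x_n,y_n)}=0,$$ where, when $x_n=y_n=p$, the quotients are understood as $0$ if $z_n=p$ and as $+\infty$ if $z_n\ne p$. Nonnegative curvature in the sense of Aleksandrov has its usual meaning for geodesic metric spaces, defined via Euclidean comparison triangles (geodesic triangles are not thinner than their comparison triangles; for complete geodesic spaces the local and global versions agree). *)

(* Defs.v *)
From HB Require Import structures.
From mathcomp Require Import all_boot all_order all_algebra generic_quotient.
From mathcomp Require Import all_classical all_reals all_analysis.

Set Implicit Arguments.
Unset Strict Implicit.
Unset Printing Implicit Defensive.

Import Order.TTheory GRing.Theory Num.Theory.
Import numFieldNormedType.Exports.

Local Open Scope classical_set_scope.
Local Open Scope quotient_scope.
Local Open Scope ring_scope.

Section normalizing_sequences.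
Context {R : realType}.

Record normalizing_seq := NormalizingSeq {
  nmz_fun :> nat -> R ;
  nmz_gt0 : forall n, 0 < nmz_fun n ;
  nmz_cvg0 : nmz_fun @ \oo --> 0 }.

Definition strictly_increasing (nk : nat -> nat) :=
  {homo nk : m n / (m < n)%N}.

Lemma strictly_increasing_cvg nk : strictly_increasing nk ->
  nk @ \oo --> \oo.
Proof.
move=> nkS A [N _ NA]; exists N => // n /= Nn; apply: NA => /=.
apply: leq_trans Nn _; elim: n => // n IH.
by apply: leq_ltn_trans IH _; apply: nkS.
Qed.

Lemma subseq_cvg0 (r : normalizing_seq) nk :
  strictly_increasing nk -> (r \o nk) @ \oo --> 0.
Proof.
by move=> /strictly_increasing_cvg nkoo; apply: cvg_comp nkoo (@nmz_cvg0 r).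
Qed.

Definition subseq_normalizing (r : normalizing_seq) nk
    (nkS : strictly_increasing nk) : normalizing_seq :=
  NormalizingSeq (fun n => nmz_gt0 r (nk n)) (@subseq_cvg0 r nk nkS).

End normalizing_sequences.
Arguments normalizing_seq R : clear implicits.

Section stability.
Context {R : realType} {X : metricType R}.
Implicit Types (r : normalizing_seq R) (x y z : nat -> X)
  (F : set (nat -> X)).

Definition scaled_dist r x y : nat -> R :=
  fun n => mdist (x n) (y n) / r n.

(* Convergence takes place in R, so the limit is finite. *)
Definition mutually_stable r x y := cvgn (scaled_dist r x y).

(* Meaningful when x and y are mutually stable. *)
Definition stable_dist r x y : R := limn (scaled_dist r x y).

Definition self_stable r F :=
  forall x y, F x -> F y -> mutually_stable r x y.

Definition maximal_self_stable r F :=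
  self_stable r F /\
  forall z, ~ F z -> exists2 x, F x & ~ mutually_stable r x z.

Record pretangent_family (p : X) r := PretangentFamily {
  pfam_set :> set (nat -> X) ;
  pfam_max : maximal_self_stable r pfam_set ;
  pfam_base : pfam_set (cst p) }.

Lemma stable_distxx r x : stable_dist r x x = 0.
Proof.
rewrite /stable_dist (_ : scaled_dist r x x = cst 0) ?lim_cst//.
by apply/funext => n; rewrite /scaled_dist mdistxx mul0r.
Qed.

Lemma stable_dist_sym r x y : stable_dist r x y = stable_dist r y x.
Proof.
congr (lim (_ @ \oo)); apply/funext => n.
by rewrite /scaled_dist metric_sym.
Qed.

Lemma stable_dist_ge0 r x y : mutually_stable r x y -> 0 <= stable_dist r x y.
Proof.
move=> cxy; apply: limr_ge => //; apply: nearW => n.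
by rewrite divr_ge0 ?mdist_ge0// ltW// nmz_gt0.
Qed.

Lemma stable_dist_triangle r y x z :
  mutually_stable r x y -> mutually_stable r y z -> mutually_stable r x z ->
  stable_dist r x z <= stable_dist r x y + stable_dist r y z.
Proof.
move=> cxy cyz cxz; rewrite /stable_dist -limD//.
apply: ler_lim => //; first exact: is_cvgD.
apply: nearW => n; rewrite /= /scaled_dist -mulrDl.
by rewrite ler_pM2r ?invr_gt0 ?nmz_gt0// metric_triangle.
Qed.

End stability.

Section pretangent_space.
Context {R : realType} {X : metricType R} {p : X} {r : normalizing_seq R}.
Variable F : pretangent_family p r.

Lemma pfam_stable (a b : F) : mutually_stable r (val a) (val b).
Proof. by apply: (pfam_max F).1; apply: set_mem; apply: valP. Qed.

Definition dist0_rel (a b : F) : bool := stable_dist r (val a) (val b) == 0.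

Let dist0_le (a b c : F) : stable_dist r (val a) (val b) = 0 ->
  stable_dist r (val a) (val c) <= stable_dist r (val b) (val c).
Proof.
move=> ab; rewrite -[leRHS]add0r -ab.
by apply: stable_dist_triangle; exact: pfam_stable.
Qed.

Let dist0_eq (a b c : F) : stable_dist r (val a) (val b) = 0 ->
  stable_dist r (val a) (val c) = stable_dist r (val b) (val c).
Proof.
move=> ab; apply/eqP; rewrite eq_le dist0_le//= dist0_le//.
by rewrite stable_dist_sym.
Qed.

Lemma dist0_equiv : equiv_class_of dist0_rel.
Proof.
split=> [a|a b|b a c ab bc]; rewrite /dist0_rel.
- by rewrite stable_distxx.
- by rewrite stable_dist_sym.
- by move: bc; rewrite /dist0_rel -(@dist0_eq a b)//; apply/eqP.
Qed.

Canonical dist0_equiv_rel := EquivRelPack dist0_equiv.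

Definition pretangent : Type := {eq_quot dist0_equiv_rel}.

HB.instance Definition _ := Choice.on pretangent.
HB.instance Definition _ := EqQuotient.on pretangent.

Definition pretangent_dist (u v : pretangent) : R :=
  stable_dist r (val (repr u)) (val (repr v)).

Lemma pretangent_distE (a b : F) :
  pretangent_dist (\pi_pretangent a) (\pi_pretangent b) =
  stable_dist r (val a) (val b).
Proof.
have reprE (c : F) :
    stable_dist r (val (repr (\pi_pretangent c))) (val c) = 0.
  by apply/eqP; apply/(eqmodP dist0_equiv_rel); rewrite reprK.
rewrite /pretangent_dist (dist0_eq _ (reprE a)) stable_dist_sym.
by rewrite (dist0_eq _ (reprE b)) stable_dist_sym.
Qed.

Let pretangent_distxx u : pretangent_dist u u = 0.
Proof. exact: stable_distxx. Qed.

Let pretangent_dist_eq0 u v : pretangent_dist u v = 0 -> u = v.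
Proof.
move=> uv; rewrite -[u]reprK -[v]reprK.
by apply/(eqmodP dist0_equiv_rel); apply/eqP.
Qed.

Let pretangent_dist_sym u v : pretangent_dist u v = pretangent_dist v u.
Proof. exact: stable_dist_sym. Qed.

Let pretangent_dist_triangle v u w :
  pretangent_dist u w <= pretangent_dist u v + pretangent_dist v w.
Proof. by apply: stable_dist_triangle; exact: pfam_stable. Qed.

HB.instance Definition _ := isMetric.Build R pretangent
  pretangent_distxx pretangent_dist_eq0 pretangent_dist_sym
  pretangent_dist_triangle.

Lemma mdist_pretangentE (a b : F) :
  mdist (\pi_pretangent a) (\pi_pretangent b : pretangent) =
  stable_dist r (val a) (val b).
Proof. exact: pretangent_distE. Qed.

End pretangent_space.

Section tangent_space.
Context {R : realType} {X : metricType R} {p : X} {r : normalizing_seq R}.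
Variable F : pretangent_family p r.

Section embedding.
Variables (nk : nat -> nat) (nkS : strictly_increasing nk).
Variable F' : pretangent_family p (subseq_normalizing r nkS).
Hypothesis FF' : [set x \o nk | x in pfam_set F] `<=` pfam_set F'.

Definition sub_elt (a : F) : F' :=
  SigSub (mem_set (FF' (imageP _ (set_mem (valP a))))).

Definition tangent_embedding (u : pretangent F) : pretangent F' :=
  \pi_(pretangent F') (sub_elt (repr u)).

Lemma stable_dist_sub (a b : F) :
  stable_dist (subseq_normalizing r nkS) (val (sub_elt a)) (val (sub_elt b)) =
  stable_dist r (val a) (val b).
Proof.
apply: cvg_lim => //.
exact: cvg_comp (strictly_increasing_cvg nkS) (pfam_stable (a := a) (b := b)).
Qed.

Lemma tangent_embedding_pi (a : F) :
  tangent_embedding (\pi_(pretangent F) a) = \pi_(pretangent F') (sub_elt a).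
Proof.
apply: mdist_positivity; rewrite mdist_pretangentE stable_dist_sub.
by rewrite -mdist_pretangentE reprK mdistxx.
Qed.

Lemma tangent_embedding_isometry (u v : pretangent F) :
  mdist (tangent_embedding u) (tangent_embedding v) = mdist u v.
Proof. by rewrite mdist_pretangentE stable_dist_sub. Qed.

End embedding.

Definition tangent :=
  forall (nk : nat -> nat) (nkS : strictly_increasing nk)
    (F' : pretangent_family p (subseq_normalizing r nkS))
    (FF' : [set x \o nk | x in pfam_set F] `<=` pfam_set F'),
    bijective (tangent_embedding FF').

End tangent_space.

Definition separable (T : topologicalType) :=
  exists2 D : set T, countable D & dense D.

Section infinitesimal_conditions.
Context {R : realType} {X : metricType R}.
Variable p : X.

(* |d(x,z) - d(x,y)/2| / max{d(x,p), d(y,p)}; in the definition below it is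
   also used with x and y exchanged. *)
Definition midpoint_defect (x y z : X) : \bar R :=
  if (x == p) && (y == p) then (if z == p then 0 else +oo)%E
  else (`|mdist x z - mdist x y / 2| / Num.max (mdist x p) (mdist y p))%:E.

Definition midpoint_convex_at :=
  forall x y : nat -> X, x @ \oo --> p -> y @ \oo --> p ->
  exists z : nat -> X,
    midpoint_defect (x n) (y n) (z n) @[n --> \oo] --> 0%E /\
    midpoint_defect (y n) (x n) (z n) @[n --> \oo] --> 0%E.

Definition A2 (w x y z : X) : R :=
  if [&& w == p, x == p, y == p & z == p] then 0 else
  (mdist w x ^+ 2 + mdist w y ^+ 2 + mdist w z ^+ 2
   - 3^-1 * (mdist x y ^+ 2 + mdist y z ^+ 2 + mdist z x ^+ 2))
  / (Num.max (Num.max (mdist w p) (mdist x p))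
             (Num.max (mdist y p) (mdist z p))) ^+ 2.

(* Since A2 vanishes at (p,p,p,p), keeping that point in the neighbourhoods
   does not affect the nonnegativity of the lower limit. *)
Definition liminf_A2 : \bar R :=
  limf_einf (fun q : X * X * X * X => (A2 q.1.1.1 q.1.1.2 q.1.2 q.2)%:E)
    (nbhs (p, p, p, p)).

End infinitesimal_conditions.

Section aleksandrov.
Context {R : realType}.

(* The norm of 'rV[R]_2 in the library is the sup norm, hence this distance. *)
Definition plane_dist (u v : 'rV[R]_2) : R :=
  Num.sqrt (\sum_i (u 0 i - v 0 i) ^+ 2).

Variable M : metricType R.

(* Shortest path from x to y, parametrized on [0, 1] proportionally to
   arc length. *)
Definition is_geodesic (g : R -> M) (x y : M) :=
  [/\ g 0 = x, g 1 = y &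
      forall s t, 0 <= s <= 1 -> 0 <= t <= 1 ->
        mdist (g s) (g t) = mdist x y * `|s - t|].

Definition geodesic_space :=
  forall x y : M, exists g : R -> M, is_geodesic g x y.

Definition comparison_triangle (x y z : M) (x' y' z' : 'rV[R]_2) :=
  [/\ plane_dist x' y' = mdist x y, plane_dist y' z' = mdist y z &
      plane_dist z' x' = mdist z x].

(* The distance between two points of a geodesic triangle is at least the
   distance between their comparison points.  For points on one side there is
   equality; for points on two different sides, x is the common vertex. *)
Definition triangles_not_thinner :=
  forall (x y z : M) (g h : R -> M) (x' y' z' : 'rV[R]_2),
    is_geodesic g x y -> is_geodesic h x z ->
    comparison_triangle x y z x' y' z' ->
    forall s t, 0 <= s <= 1 -> 0 <= t <= 1 ->
      plane_dist ((1 - s) *: x' + s *: y') ((1 - t) *: x' + t *: z')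
        <= mdist (g s) (h t).

Definition nonneg_curved_aleksandrov :=
  geodesic_space /\ triangles_not_thinner.

End aleksandrov.

(* Main.v *)
Require Import Defs.
From mathcomp Require Import all_boot all_order all_algebra.
From mathcomp Require Import all_classical all_reals all_analysis.
From mathcomp Require Import generic_quotient lra ring.

(* The inequality A_2 >= 0 passes to the limit in the pretangent space: for any
   w, x, y, z there,
     d(w,x)^2 + d(w,y)^2 + d(w,z)^2 >= (d(x,y)^2 + d(y,z)^2 + d(z,x)^2) / 3.
   Pretangent spaces are complete, by a diagonal construction and the
   maximality of the family.  An infinitesimal midpoint of two members of the
   family need not be stable with respect to the whole family, but by
   separability it becomes so along a subsequence, and tangency brings the
   midpoint back into the space; hence the space is geodesic.
   In a geodesic space, let m be a midpoint of x and y, let w_s run through a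
   geodesic from m to z, and let D(s) be the excess of d(w_s,x)^2 + d(w_s,y)^2
   over its Euclidean value 2 d(w_s,m)^2 + d(x,y)^2 / 2.  The inequality for
   (w_{s/3}; x, y, w_s) gives D(s) <= 3 D(s/3), and the one for (m; x, y, w_s)
   gives D(s) <= s^2 d(m,z)^2, so that D(1) <= 3^n 9^-n d(m,z)^2 -> 0.  This is
   the comparison for midpoints, which yields the comparison for arbitrary
   points on the sides. *)

Set Implicit Arguments.
Unset Strict Implicit.
Unset Printing Implicit Defensive.

Import Order.TTheory GRing.Theory Num.Theory.
Import numFieldNormedType.Exports.

Local Open Scope classical_set_scope.
Local Open Scope quotient_scope.
Local Open Scope ring_scope.

(** * Maximal cliques of a relation *)

Definition clique T (e : T -> T -> Prop) (A : set T) :=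
  forall x y, A x -> A y -> e x y.

(** Zorn's lemma runs over the sets [B] whose union with [A] is a clique, so that the empty chain
    needs no separate treatment. Partial geodesics and self-stable families are both cliques in this
    sense. *)
Lemma maximal_clique T (e : T -> T -> Prop) (A : set T) :
  (forall x, e x x) -> (forall x y, e x y -> e y x) -> clique e A ->
  exists B, [/\ A `<=` B, clique e B &
    forall z, (forall x, B x -> e x z) -> B z].
Proof.
move=> e_refl e_sym cA.
have [|B [cB maxB]] := @Zorn_bigcup T [set B | clique e (A `|` B)].
  move=> /= C subC totC x y.
  move=> [Ax|[B1 CB1 B1x]] [Ay|[B2 CB2 B2y]]; first exact: cA.
  - by apply: (subC _ CB2); [left|right].
  - by apply: (subC _ CB1); [right|left].
  - have [B12|B21] := totC _ _ CB1 CB2.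
      by apply: (subC _ CB2); right=> //; exact: B12.
    by apply: (subC _ CB1); right=> //; exact: B21.
exists (A `|` B); split=> // z ez; right.
apply: contrapT => nBz; apply: (maxB (z |` B)).
  split; first by move=> x Bx; right.
  by move=> sub; apply: nBz; apply: sub; left.
have: forall x, (A `|` (z |` B)) x -> (A `|` B) x \/ x = z.
  by move=> x [Ax|[->|Bx]]; [left; left|right|left; right].
move=> h x y /h[ABx|->] /h[ABy|->] //; [exact: cB|exact: ez|].
by apply: e_sym; exact: ez.
Qed.

(** * Complete metric spaces with midpoints *)

Section MidpointsGeodesics.
Context {R : realType} {M : metricType R}.
Implicit Types (u v w x y z m : M).

Lemma mdist_diff_le w u v : `|mdist w u - mdist w v| <= mdist u v.
Proof.
have := metric_triangle w v u; have := metric_triangle w u v.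
rewrite (metric_sym v u) ler_norml; lra.
Qed.

Definition midpoint m x y :=
  mdist x m = mdist x y / 2 /\ mdist y m = mdist x y / 2.

(* A geodesic is a maximal isometric (up to the factor d(x,y)) relation between
   parameters and points: its domain is closed by completeness, and a gap in it
   could be filled with a midpoint. *)
Lemma complete_midpoints_geodesic :
  (forall a : nat -> M, cauchy (a @ \oo) -> exists l : M, a @ \oo --> l) ->
  (forall x y, exists m, midpoint m x y) -> geodesic_space M.
Proof.
move=> compl mid x y; set a := mdist x y.
have a0 : 0 <= a by exact: mdist_ge0.
pose e (p q : R * M) := mdist p.2 q.2 = a * `|p.1 - q.1|.
have [||p q|C [subC cC maxC]] := @maximal_clique _ e [set (0, x); (1, y)].
- by move=> p; rewrite /e mdistxx subrr normr0 mulr0.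
- by move=> p q; rewrite /e metric_sym distrC.
- move=> [->|->] [->|->]; rewrite /e/= ?mdistxx.
  + by rewrite subrr normr0 mulr0.
  + by rewrite sub0r normrN1 mulr1.
  + by rewrite subr0 normr1 mulr1 metric_sym.
  + by rewrite subrr normr0 mulr0.
have C0 : C (0, x) by apply: subC; left.
have C1 : C (1, y) by apply: subC; right.
(* The parameters of [C] form a closed set: points whose parameters tend to [t] are Cauchy, their
   limit is compatible with all of [C], and maximality admits it. *)
have closedC t : (forall d, 0 < d -> exists2 q, C q & `|q.1 - t| < d) ->
    exists v, C (t, v).
  move=> appr.
  have /choice[q qP] (k : nat) : exists q, C q /\ `|q.1 - t| < k.+1%:R^-1.
    by have [|q Cq qt] := appr (k.+1%:R^-1); [rewrite invr_gt0|exists q].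
  have qd d : 0 < d -> \forall n \near \oo, a * `|(q n).1 - t| < d.
    move=> d0; have [N _ Nd] : \forall n \near \oo, a * n.+1%:R^-1 < d :> R.
      have : a * n.+1%:R^-1 @[n --> \oo] --> a * 0.
        by apply: cvgMr; exact: cvg_harmonic.
      rewrite mulr0 => /cvgrPdist_lt /(_ d d0); apply: filterS => n.
      by rewrite /= sub0r normrN; apply: le_lt_trans; exact: ler_norm.
    exists N => // n /Nd; apply: le_lt_trans.
    by rewrite ler_wpM2l// ltW// (qP n).2.
  have [|v qv] := compl (snd \o q).
    apply/cauchyP => d d0; have d20 : 0 < d / 2 by rewrite divr_gt0.
    have [N _ Nd] := qd _ d20.
    exists (q N).2; exists N => // n /= Nn; rewrite ballEmdist/=.
    rewrite (cC _ _ (qP N).1 (qP n).1) [d]splitr.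
    apply: le_lt_trans (ltrD (Nd N (leqnn N)) (Nd n Nn)).
    by rewrite -mulrDr ler_wpM2l// (distrC (q n).1) ler_distD.
  exists v; apply: maxC => p Cp; rewrite /e/=.
  apply/eqP; rewrite -subr_eq0 -normr_le0; apply/ler_addgt0Pl => d d0.
  rewrite addr0; have d20 : 0 < d / 2 by rewrite divr_gt0.
  have /metricType_numDomainType.cvgrPdist_lt /(_ _ d20)[N1 _ HN1] := qv.
  have [N2 _ HN2] := qd _ d20; pose n := maxn N1 N2.
  have := HN1 n (leq_maxl _ _); have := HN2 n (leq_maxr _ _) => /=.
  have := mdist_diff_le p.2 v (q n).2; have := cC _ _ Cp (qP n).1; rewrite /e.
  have : `| `|p.1 - (q n).1| - `|p.1 - t| | <= `|(q n).1 - t|.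
    apply: le_trans (ler_dist_dist _ _) _.
    by rewrite (_ : _ - _ = - ((q n).1 - t)) ?normrN//; ring.
  move=> /(ler_wpM2l a0).
  rewrite -{1}(ger0_norm a0) -normrM mulrBr.
  move=> + ->; rewrite !ler_norml; lra.
have mid01 s : 0 <= s <= 1 -> exists v, C (s, v).
  (* A missing [s] lies in a gap of the parameters; by closedness both ends of the gap, [sup A] and
     [inf B], are parameters. *)
  move=> /andP[s0 s1]; apply: contrapT => nCs.
  pose A := [set t | t <= s /\ exists v, C (t, v)].
  pose B := [set t | s <= t /\ exists v, C (t, v)].
  have A0 : A 0 by split=> //; exists x.
  have B1 : B 1 by split=> //; exists y.
  have supA : has_sup A by split; [exists 0|exists s => t []].
  have infB : has_inf B by split; [exists 1|exists s => t []].
  have [v Cv] : exists v, C (sup A, v).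
    apply: closedC => d d0; have [t [ts [v Ctv]] td] := sup_adherent d0 supA.
    exists (t, v) => //=; rewrite ltr_distl.
    have := ub_le_sup supA.2 (conj ts (ex_intro _ v Ctv)); lra.
  have [w Cw] : exists w, C (inf B, w).
    apply: closedC => d d0; have [t [ts [w Ctw]] td] := inf_adherent d0 infB.
    exists (t, w) => //=; rewrite ltr_distl.
    have := ge_inf infB.2 (conj ts (ex_intro _ w Ctw)); lra.
  have As : sup A <= s by apply: ge_sup; [exists 0|move=> t []].
  have Bs : s <= inf B by apply: lb_le_inf; [exists 1|move=> t []].
  have Ans : sup A != s by apply/eqP => h; apply: nCs; exists v; rewrite -h.
  have Bns : inf B != s by apply/eqP => h; apply: nCs; exists w; rewrite -h.
  have {As Ans}As : sup A < s by rewrite lt_neqAle Ans.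
  have {Bs Bns}Bs : s < inf B by rewrite lt_neqAle eq_sym Bns.
  have dvw : mdist v w = a * (inf B - sup A).
    by rewrite (cC _ _ Cv Cw)/= distrC gtr0_norm// subr_gt0 (lt_trans As).
  have [m [vm wm]] := mid v w.
  have Cm : C ((sup A + inf B) / 2, m).
    (* For [t <= sup A] the path [u], [v], [m] bounds d(u,m) from above, and the path [u], [m], [w]
       bounds it from below; for [inf B <= t] exchange [v] and [w]. *)
    apply: maxC => -[t u] Ctu; rewrite /e/=.
    have := metric_triangle u v m; have := metric_triangle u w m.
    have := metric_triangle u m v; have := metric_triangle u m w.
    rewrite (metric_sym m v) (metric_sym m w) vm wm dvw.
    have := cC _ _ Ctu Cv; have := cC _ _ Ctu Cw; rewrite /e/=.
    have [tA|tB] : t <= sup A \/ inf B <= t.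
    + have [ts|st] := leP t s; [left|right].
      * exact: (ub_le_sup supA.2 (conj ts (ex_intro _ u Ctu))).
      * exact: (ge_inf infB.2 (conj (ltW st) (ex_intro _ u Ctu))).
    + by rewrite !ler0_norm; lra.
    + by rewrite !ger0_norm; lra.
  have [ms|sm] := leP ((sup A + inf B) / 2) s.
  - have : (sup A + inf B) / 2 <= sup A.
      exact: (ub_le_sup supA.2 (conj ms (ex_intro _ m Cm))).
    lra.
  - have : inf B <= (sup A + inf B) / 2.
      exact: (ge_inf infB.2 (conj (ltW sm) (ex_intro _ m Cm))).
    lra.
have /choice[g gP] (s : R) : exists v, 0 <= s <= 1 -> C (s, v).
  have [/mid01[v]|ns] := boolP (0 <= s <= 1); first by exists v.
  by exists x.
exists g; split.
- have := cC _ _ C0 (gP 0 _); rewrite /e/= lexx ler01 subrr normr0 mulr0.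
  by move=> /(_ isT) /mdist_positivity.
- have := cC _ _ C1 (gP 1 _); rewrite /e/= lexx ler01 subrr normr0 mulr0.
  by move=> /(_ isT) /mdist_positivity.
- by move=> s t s01 t01; apply: cC (gP s s01) (gP t t01).
Qed.

End MidpointsGeodesics.

(** * The three-point inequality in geodesic spaces *)

Lemma le0_geometric (R : realType) (u K q : R) :
  0 <= q < 1 -> (forall n, u <= K * q ^+ n) -> u <= 0.
Proof.
move=> /andP[q0 q1] uK.
have Kq : K * q ^+ n @[n --> \oo] --> (0 : R).
  by apply: cvg_geometric; rewrite ger0_norm.
rewrite -(cvg_lim _ Kq)//; apply: limr_ge; first by apply/cvg_ex; exists 0.
exact: nearW.
Qed.

Section ThreePointInequality.
Context {R : realType} {M : metricType R}.
Implicit Types (u v w x y z m : M).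

(** In a Euclidean space the right side minus the left side is three times the squared distance from
    [w] to the centroid of [x], [y], [z]. *)
Definition three_point_inequality := forall w x y z : M,
  3^-1 * (mdist x y ^+ 2 + mdist y z ^+ 2 + mdist z x ^+ 2) <=
  mdist w x ^+ 2 + mdist w y ^+ 2 + mdist w z ^+ 2.

Hypothesis tpi : three_point_inequality.

Lemma midpoint_comparison x y z m : geodesic_space M -> midpoint m x y ->
  mdist z x ^+ 2 / 2 + mdist z y ^+ 2 / 2 - mdist x y ^+ 2 / 4 <=
  mdist z m ^+ 2.
Proof.
move=> geo [xm ym]; have [g [g0 g1 gE]] := geo m z.
pose D s := mdist (g s) x ^+ 2 + mdist (g s) y ^+ 2
  - 2 * (s * mdist m z) ^+ 2 - mdist x y ^+ 2 / 2.
(* This a priori bound is quadratic in [s], which outweighs the factor 3 lost at each step of the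
   iteration. *)
have D_le s : 0 <= s <= 1 -> D s <= (s * mdist m z) ^+ 2.
  move=> s01; have := tpi m x y (g s).
  rewrite (metric_sym m x) (metric_sym m y) xm ym -{1}g0 gE ?lexx ?ler01//.
  rewrite sub0r normrN ger0_norm; last by case/andP: s01.
  by rewrite (metric_sym y (g s)) /D; lra.
(* In the plane [g (s / 3)] would be the centroid of [x], [y], [g s], where the inequality is
   sharp. *)
have D_third s : 0 <= s <= 1 -> D s <= 3 * D (s / 3).
  move=> s01; have := tpi (g (s / 3)) x y (g s).
  rewrite gE//; last by lra.
  rewrite exprMn real_normK ?num_real// (metric_sym y (g s)) /D; lra.
have D1 n : D 1 <= mdist m z ^+ 2 * 3^-1 ^+ n.
  have third01 k : 0 <= (3^-1 : R) ^+ k <= 1.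
    by rewrite exprn_ge0 ?exprn_ile1//; lra.
  have D1n : D 1 <= 3 ^+ n * D (3^-1 ^+ n).
    elim: n => [|n IH]; first by rewrite !expr0 mul1r.
    apply: le_trans IH _; rewrite exprSr -mulrA ler_pM2l ?exprn_gt0//.
    by rewrite [3^-1 ^+ n.+1]exprSr; exact: D_third.
  apply: le_trans D1n _.
  apply: (@le_trans _ _ (3 ^+ n * (3^-1 ^+ n * mdist m z) ^+ 2)).
    by rewrite ler_pM2l ?exprn_gt0// D_le.
  have : 3 ^+ n * 3^-1 ^+ n = 1 :> R by rewrite -exprMn mulfV// expr1n.
  move: (3 ^+ n) (3^-1 ^+ n) => a b ab.
  have -> : a * (b * mdist m z) ^+ 2 = a * b * (mdist m z ^+ 2 * b) by ring.
  by rewrite ab mul1r.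
have third01 : 0 <= (3^-1 : R) < 1 by lra.
have := le0_geometric third01 D1.
by rewrite /D g1 mul1r (metric_sym m z); lra.
Qed.

Lemma geodesic_midpoint g x y s t : is_geodesic g x y ->
  0 <= s <= 1 -> 0 <= t <= 1 -> midpoint (g ((s + t) / 2)) (g s) (g t).
Proof.
move=> [_ _ gE] s01 t01; have st01 : 0 <= (s + t) / 2 <= 1 by lra.
have h (c : R) : `|c / 2| = `|c| / 2.
  by rewrite normrM (ger0_norm (_ : 0 <= 2^-1)).
split; rewrite !gE// -mulrA -h.
  by congr (_ * `|_|); field.
by rewrite distrC; congr (_ * `|_|); field.
Qed.

(* The defect phi is bounded above and midpoint convex, and it vanishes at 0 and
   1, so that any upper bound of phi can be halved. *)
Lemma geodesic_comparison g x y q s : geodesic_space M -> is_geodesic g x y ->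
  0 <= s <= 1 ->
  (1 - s) * mdist x q ^+ 2 + s * mdist y q ^+ 2
    - s * (1 - s) * mdist x y ^+ 2 <= mdist (g s) q ^+ 2.
Proof.
move=> geo gxy s01; have [g0 g1 gE] := gxy.
pose phi s := (1 - s) * mdist x q ^+ 2 + s * mdist y q ^+ 2
  - s * (1 - s) * mdist x y ^+ 2 - mdist (g s) q ^+ 2.
(* The term d(g t, g c)^2 / 4 of the midpoint comparison cancels against the concavity of s(1 -
   s). *)
have phi_mid (t c : R) : 0 <= t <= 1 -> 0 <= c <= 1 ->
    phi ((t + c) / 2) <= (phi t + phi c) / 2.
  move=> t01 u01.
  have := midpoint_comparison q geo (geodesic_midpoint gxy t01 u01).
  rewrite !(metric_sym q) gE// exprMn real_normK ?num_real// /phi; lra.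
have phi0 : phi 0 = 0 by rewrite /phi g0; ring.
have phi1 : phi 1 = 0 by rewrite /phi g1; ring.
suff : phi s <= 0 by rewrite /phi; lra.
have half01 : 0 <= (2^-1 : R) < 1 by lra.
apply: (le0_geometric (K := mdist x q ^+ 2 + mdist y q ^+ 2) half01) => n.
set K := _ + _; elim: n s s01 => [|n IH] s s01.
  rewrite expr0 mulr1 /phi /K.
  case/andP: s01 => s0; rewrite -subr_ge0 => s1.
  have := mulr_ge0 s0 (sqr_ge0 (mdist x q)).
  have := mulr_ge0 s1 (sqr_ge0 (mdist y q)).
  have := mulr_ge0 (mulr_ge0 s0 s1) (sqr_ge0 (mdist x y)).
  have := sqr_ge0 (mdist (g s) q); lra.
(* In the left half [s] is the midpoint of 0 and [2 * s], in the right half that of [2 * s - 1] and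
   1; [phi] vanishes at the outer end. *)
rewrite exprSr mulrA; have [s2|s2] := leP s (2^-1).
  have t01 : 0 <= 2 * s <= 1 by lra.
  have := phi_mid _ _ t01 (_ : 0 <= 0 <= 1); rewrite addr0 phi0 addr0.
  rewrite lexx ler01 (_ : 2 * s / 2 = s); last by field.
  by move=> /(_ isT); have := IH _ t01; lra.
have t01 : 0 <= 2 * s - 1 <= 1 by lra.
have := phi_mid _ _ t01 (_ : 0 <= 1 <= 1); rewrite subrK phi1 addr0.
rewrite lexx ler01 (_ : 2 * s / 2 = s); last by field.
by move=> /(_ isT); have := IH _ t01; lra.
Qed.

Lemma plane_distE (u v : 'rV[R]_2) :
  plane_dist u v ^+ 2 = (u 0 0 - v 0 0) ^+ 2 + (u 0 1 - v 0 1) ^+ 2.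
Proof.
rewrite /plane_dist sqr_sqrtr; last first.
  by rewrite sumr_ge0// => i _; exact: sqr_ge0.
rewrite !big_ord_recl big_ord0 addr0.
by rewrite (_ : lift ord0 ord0 = 1)//; exact: val_inj.
Qed.

(** The comparison is used twice, for [y] against [h] and then for [h t] against [g]. In the plane
    both are equalities (Stewart's theorem), so together they give exactly the comparison
    distance. *)
Lemma three_point_not_thinner : geodesic_space M -> triangles_not_thinner M.
Proof.
move=> geo x y z g h x' y' z' gxy hxz [xy yz zx] s t s01 t01.
rewrite -[leRHS](ger0_norm (mdist_ge0 _ _)) -[leLHS](ger0_norm (sqrtr_ge0 _)).
rewrite -ler_sqr ?nnegrE// !real_normK ?num_real//.
have := geodesic_comparison y geo hxz t01.
have := geodesic_comparison (h t) geo gxy s01.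
have [h0 h1 hE] := hxz.
have -> : mdist x (h t) = mdist x z * `|0 - t|.
  by rewrite -{1}h0 hE// lexx ler01.
rewrite exprMn real_normK ?num_real//.
rewrite (metric_sym (h t)) (metric_sym x z) (metric_sym z y) -xy -yz -zx.
rewrite !plane_distE !mxE.
case/andP: s01 => s0 _ H /(ler_wpM2l s0); lra.
Qed.

End ThreePointInequality.

(** * Stable sequences and completeness of pretangent spaces *)

(** Take for [c n] the largest [k <= n] with [P k n]; [P 0] provides one such [k], and the cap [n]
    makes the maximum exist. *)
Lemma diagonal_index (P : nat -> nat -> Prop) :
  (forall n, P 0%N n) -> (forall k, \forall n \near \oo, P k n) ->
  exists c : nat -> nat, (forall n, P (c n) n) /\
    forall k, \forall n \near \oo, (k <= c n)%N.
Proof.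
move=> P0 Pk.
have /choice[c cP] n : exists k, P k n /\
    forall j, (j <= n)%N -> P j n -> (j <= k)%N.
  pose Q := [pred k | `[< P k n >] && (k <= n)%N].
  have exQ : exists k, Q k by exists 0%N; rewrite /= leq0n andbT; exact/asboolP.
  have ubQ k : Q k -> (k <= n)%N by case/andP.
  have [k /andP[/asboolP Pkn _] kmax] := ex_maxnP exQ ubQ.
  exists k; split=> // j jn Pj; apply: kmax; rewrite /= jn andbT; exact/asboolP.
exists c; split=> [n|k]; first by case: (cP n).
near=> n; apply: (cP n).2; near: n; first exact: nbhs_infty_ge.
exact: Pk.
Unshelve. all: by end_near. Qed.

(** By Tychonoff the sequence has a cluster point [c] in a product of segments; step [k] of the
    subsequence brings the first [k + 1] coordinates within 1/(k + 1) of [c]. *)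
Lemma pointwise_cvg_subseq (R : realType) (f : nat -> nat -> R)
    (B : nat -> R) : (forall n m, 0 <= f n m <= B m) ->
  exists nk, strictly_increasing nk /\ forall m, cvgn (fun k => f (nk k) m).
Proof.
move=> fB; pose K m := `[0, B m]%classic : set R.
have cK m : compact (K m) by exact: segment_compact.
have := tychonoff cK (F := f @ \oo) (fmap_proper_filter _ _).
case=> [|c [_ fc]]; first by exists 0%N => // n _ m; rewrite /K/= in_itv/=.
have sub N k : exists n, (N <= n)%N /\
    forall m : 'I_k.+1, `|c m - f n m| < k.+1%:R^-1.
  have [] := fc [set f n | n in [set n | (N <= n)%N]]
    [set g : nat -> R | forall m : 'I_k.+1, `|c m - g m| < k.+1%:R^-1].
  - by exists N => // n /= Nn; exists n.
  - refine (@filter_forall _ _ (fun m : 'I_k.+1 =>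
      [set g : nat -> R | `|c m - g m| < k.+1%:R^-1]) (nbhs c) _ _) => m.
    have e0 : 0 < k.+1%:R^-1 :> R by rewrite invr_gt0.
    exact: (@proj_continuous _ (fun _ : nat => R) (val m) c _
      (nbhsx_ballx (c m : R) _ e0)).
  - by move=> _ [[n /= Nn <-] H]; exists n.
have /choice[h hP] (q : nat * nat) : exists n, (q.1 <= n)%N /\
    forall m : 'I_q.2.+1, `|c m - f n m| < q.2.+1%:R^-1 by exact: sub.
(* The first component passed to [h] is a lower bound for the next index, which makes [nk] strictly
   increasing. *)
pose nk := fix nk k := if k is k'.+1 then h ((nk k').+1, k) else h (0, 0)%N.
exists nk; split.
  apply: homo_ltn; first exact: ltn_trans.
  by move=> k; exact: (hP (_, _)).1.
move=> m; apply/cvg_ex; exists (c m); apply/cvgrPdist_lt => e e0; near=> k.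
have km : (m < k.+1)%N by near: k; exact: nbhs_infty_ge.
have := (hP (if k is k'.+1 then (nk k').+1 else 0%N, k)).2 (Ordinal km).
rewrite (_ : h _ = nk k); last by case: (k).
move=> /lt_trans; apply; near: k.
by have /cvgrPdist_lt/(_ e e0) := @cvg_harmonic R; apply: filterS => k;
  rewrite sub0r normrN /= ger0_norm.
Unshelve. all: by end_near. Qed.

Section Stability.
Context {R : realType} {X : metricType R}.
Implicit Types (r : normalizing_seq R) (x y z : nat -> X) (A : set (nat -> X)).

Lemma scaled_distC r x y : scaled_dist r x y = scaled_dist r y x.
Proof. by apply/funext => n; rewrite /scaled_dist metric_sym. Qed.

Lemma mutually_stableC r x y : mutually_stable r x y -> mutually_stable r y x.
Proof. by rewrite /mutually_stable scaled_distC. Qed.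

Lemma mutually_stablexx r x : mutually_stable r x x.
Proof.
rewrite /mutually_stable (_ : scaled_dist r x x = cst 0).
  exact: is_cvg_cst.
by apply/funext => n; rewrite /scaled_dist mdistxx mul0r.
Qed.

Lemma scaled_dist_ge0 r x y n : 0 <= scaled_dist r x y n.
Proof. by rewrite divr_ge0 ?mdist_ge0// ltW// nmz_gt0. Qed.

Lemma scaled_dist_triangle r y x z n :
  scaled_dist r x z n <= scaled_dist r x y n + scaled_dist r y z n.
Proof.
by rewrite /scaled_dist -mulrDl ler_pM2r ?invr_gt0 ?nmz_gt0// metric_triangle.
Qed.

Lemma scaled_dist_diff_le r x y z n :
  `|scaled_dist r x z n - scaled_dist r y z n| <= scaled_dist r x y n.
Proof.
have := scaled_dist_triangle r y x z n; have := scaled_dist_triangle r x y z n.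
by rewrite (scaled_distC r y x) ler_norml; lra.
Qed.

Lemma mutually_stable_subseq r nk (nkS : strictly_increasing nk) x y :
  mutually_stable r x y ->
  mutually_stable (subseq_normalizing r nkS) (x \o nk) (y \o nk).
Proof.
move=> xy; apply/cvg_ex; exists (stable_dist r x y).
exact: cvg_comp (strictly_increasing_cvg nkS) xy.
Qed.

(** Stability with [z] survives approximation in scaled distance, since the scaled distances are
    then Cauchy. This serves both completeness and the passage from a dense set to the whole
    family. *)
Lemma mutually_stable_approx r x z :
  (forall e, 0 < e -> exists2 y, mutually_stable r y z &
    \forall n \near \oo, scaled_dist r x y n < e) ->
  mutually_stable r x z.
Proof.
move=> appr; apply: R_complete; apply/cauchyP => e e0.
have e20 : 0 < e / 2 by rewrite divr_gt0.
have [y yz xy] := appr _ e20.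
exists (stable_dist r y z).
suff : \forall n \near \oo, ball (stable_dist r y z) e (scaled_dist r x z n).
  by [].
near=> n; have : scaled_dist r x y n < e / 2 by near: n.
have : `|stable_dist r y z - scaled_dist r y z n| < e / 2.
  by near: n; have /cvgrPdist_lt := yz; apply.
have := scaled_dist_diff_le r x y z n.
by rewrite /ball/= !ltr_norml ler_norml; lra.
Unshelve. all: by end_near. Qed.

Lemma pretangent_family_extend (p : X) r A :
  self_stable r A -> A (cst p) ->
  exists F : pretangent_family p r, A `<=` F.
Proof.
move=> sA Ap.
have [|x y|B [AB sB maxB]] := maximal_clique _ _ sA.
- exact: mutually_stablexx.
- exact: mutually_stableC.
have mB : maximal_self_stable r B.
  split=> // z nBz; apply: contrapT => h; apply: nBz; apply: maxB => x Bx.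
  by apply: contrapT => nxz; apply: h; exists x.
by exists (PretangentFamily mB (AB _ Ap)).
Qed.

End Stability.

Section PretangentComplete.
Context {R : realType} {X : metricType R} {p : X} {r : normalizing_seq R}.
Variable F : pretangent_family p r.

Lemma pfam_mem z : (forall a : F, mutually_stable r (val a) z) -> pfam_set F z.
Proof.
move=> h; apply: contrapT => /(pfam_max F).2[x Fx]; apply.
exact: (h (SigSub (mem_set Fx))).
Qed.

Lemma scaled_dist_cvg (u v : pretangent F) :
  scaled_dist r (val (repr u)) (val (repr v)) @ \oo --> mdist u v.
Proof. exact: pfam_stable. Qed.

(** The limit is the class of the diagonal sequence [z n = x (c n) n] with [c] growing slowly. The
    [x i] approximate [z], so [z] is stable with the family and belongs to it by maximality. *)
Lemma pretangent_complete (a : nat -> pretangent F) : cauchy (a @ \oo) ->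
  exists l : pretangent F, a @ \oo --> l.
Proof.
move=> ca; pose x k := val (repr (a k)).
(* [P k n] says that at time [n] the scaled distances from [x k] to the earlier representatives are
   within 1/(k + 1) of their limits. *)
have [||c [cP coo]] := @diagonal_index (fun k n => forall i : 'I_k.+1,
  `|mdist (a i) (a k) - scaled_dist r (x i) (x k) n| < k.+1%:R^-1).
- move=> n i; rewrite ord1 mdistxx /scaled_dist mdistxx mul0r subrr normr0.
  by rewrite invr_gt0.
- move=> k; apply: filter_forall => i.
  have /cvgrPdist_lt := scaled_dist_cvg (u := a i) (v := a k); apply.
  by rewrite invr_gt0.
pose z n := x (c n) n.
have xz e : 0 < e -> exists N, forall i, (N <= i)%N ->
    \forall n \near \oo, scaled_dist r (x i) z n < e.
  move=> e0; have e20 : 0 < e / 2 by rewrite divr_gt0.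
  have /cauchy_ballP /(_ _ e20) := ca.
  move=> [[A B] [/= [N1 _ HA] [N2 _ HB]] AB].
  exists (maxn N1 N2) => i; rewrite geq_max => /andP[iN1 iN2].
  have [N3 _ HN3] : \forall n \near \oo, n.+1%:R^-1 < e / 2 :> R.
    have /cvgrPdist_lt/(_ _ e20) := @cvg_harmonic R.
    by apply: filterS => k; rewrite sub0r normrN /= ger0_norm.
  near=> n.
  have ci : (i <= c n)%N by near: n.
  have cN3 : (N3 <= c n)%N by near: n.
  have := cP n (Ordinal (ci : (i < (c n).+1)%N)); have := HN3 _ cN3.
  have /= := AB (a i, a (c n)) (conj (HA _ iN1) (HB _ (leq_trans iN2 ci))).
  rewrite ballEmdist/= => dac rN h.
  rewrite (_ : scaled_dist _ _ _ _ = scaled_dist r (x i) (x (c n)) n)//.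
  rewrite [e]splitr; apply: lt_trans (ltrD dac rN).
  by rewrite -ltrBlDl; move: h => /=; rewrite distrC => /ltr_normlW.
have zF (b : F) : mutually_stable r z (val b).
  apply: mutually_stable_approx => e e0; have [N HN] := xz _ e0.
  exists (x N); first exact: pfam_stable.
  by rewrite scaled_distC; exact: HN.
have Fz : pfam_set F z by apply: pfam_mem => b; exact: mutually_stableC.
exists (\pi_(pretangent F) (SigSub (mem_set Fz))).
apply/metricType_numDomainType.cvgrPdist_lt => e e0.
have e20 : 0 < e / 2 by rewrite divr_gt0.
have [N HN] := xz _ e20; exists N => // i /= Ni.
rewrite -[a i]reprK mdist_pretangentE /= stable_dist_sym.
apply: (@le_lt_trans _ _ (e / 2)); last by lra.
apply: limr_le; first exact: mutually_stableC (zF (repr (a i))).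
by apply: filterS (HN i Ni) => n; exact: ltW.
Unshelve. all: by end_near. Qed.

End PretangentComplete.

(** * Geodesics and the three-point inequality in tangent spaces *)

Section TangentLimits.
Context {R : realType} {X : metricType R} {p : X} {r : normalizing_seq R}.
Variable F : pretangent_family p r.

Lemma dist_repr_pi (a : F) (v : pretangent F) :
  mdist (\pi_(pretangent F) a) v = stable_dist r (val a) (val (repr v)).
Proof. by rewrite -{1}[v]reprK mdist_pretangentE. Qed.

(** Along a subsequence [z] becomes stable with a dense countable set, hence with all of [F]. It
    then represents a point of a pretangent space for the subsequence, and surjectivity of the
    embedding returns it to that of [F]. *)
Lemma tangent_limit_point (z : nat -> X) :
  tangent F -> separable (pretangent F) ->
  (forall a : F, has_ubound (range (scaled_dist r (val a) z))) ->
  exists (u : pretangent F) (nk : nat -> nat), strictly_increasing nk /\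
    forall v : pretangent F,
      scaled_dist r (val (repr v)) z \o nk @ \oo --> mdist v u.
Proof.
move=> tan [D /countable_injP[f finj] dD] zub.
(* [e] enumerates [D] through the injection [f]; indices that [f] does not attain on [D] receive the
   base point. *)
have /choice[e eP] m : exists d : pretangent F,
    forall d', D d' -> f d' = m -> d' = d.
  have [[d [Dd fd]]|nD] := pselect (exists d, D d /\ f d = m).
    by exists d => d' Dd' fd'; apply: finj; rewrite ?inE// fd fd'.
  exists (\pi_(pretangent F) (SigSub (mem_set (pfam_base F)))) => d Dd fd.
  by exfalso; apply: nD; exists d.
have /choice[B BP] m : exists B, forall n,
    scaled_dist r (val (repr (e m))) z n <= B.
  by have [B BP] := zub (repr (e m)); exists B => n; apply: BP; exists n.
have [|nk [nkS cvgnk]] := @pointwise_cvg_subseq R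
    (fun n m => scaled_dist r (val (repr (e m))) z n) B.
  by move=> n m; rewrite scaled_dist_ge0 BP.
pose r' := subseq_normalizing r nkS.
have stab (a : F) : mutually_stable r' (val a \o nk) (z \o nk).
  apply: mutually_stable_approx => eps eps0.
  have [d [bd Dd]] : (ball (\pi_(pretangent F) a) eps)° `&` D !=set0.
    apply: dD; last exact: open_interior.
    by exists (\pi_(pretangent F) a); apply: nbhsx_ballx.
  have {bd} := interior_subset bd; rewrite ballEmdist/= dist_repr_pi => bd.
  exists (val (repr d) \o nk).
    by rewrite (eP _ _ Dd erefl); exact: cvgnk.
  have : scaled_dist r (val a) (val (repr d)) \o nk @ \oo -->
      stable_dist r (val a) (val (repr d)).
    exact: cvg_comp (strictly_increasing_cvg nkS)
      (pfam_stable (a := a) (b := repr d)).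
  by move=> H; exact: (cvgr_lt _ H).
have [||F' AF] := @pretangent_family_extend _ _ p r'
    ([set x \o nk | x in pfam_set F] `|` [set z \o nk]).
- move=> x y [[a Fa <-]|->] [[b Fb <-]|->].
  + exact: mutually_stable_subseq (pfam_stable (a := SigSub (mem_set Fa))
      (b := SigSub (mem_set Fb))).
  + exact: (stab (SigSub (mem_set Fa))).
  + by apply: mutually_stableC; exact: (stab (SigSub (mem_set Fb))).
  + exact: mutually_stablexx.
- by left; exists (cst p) => //; exact: pfam_base.
have FF' : [set x \o nk | x in pfam_set F] `<=` pfam_set F'.
  by move=> x Fx; apply: AF; left.
have Fz : pfam_set F' (z \o nk) by apply: AF; right.
pose z' : pretangent F' := \pi_(pretangent F') (SigSub (mem_set Fz)).
have [g _ gK] := tan nk nkS F' FF'.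
exists (g z'), nk; split=> // v.
rewrite -(tangent_embedding_isometry FF') gK /tangent_embedding.
rewrite mdist_pretangentE; exact: stab.
Qed.

(** Stability with the constant sequence [p] makes d(x_n, p) the product of a convergent sequence
    and [r n], which tends to 0. *)
Lemma pfam_cvg_base (a : F) : val a @ \oo --> p.
Proof.
apply/metricType_numDomainType.cvgrPdist_lt => e e0.
have pa := pfam_stable (a := SigSub (mem_set (pfam_base F))) (b := a).
have := cvgM pa (@nmz_cvg0 _ r); rewrite mulr0.
move=> /(_ _)/(cvgr_lt 0)/(_ e e0); apply: filterS => n.
by rewrite /= /scaled_dist /= divfK// gt_eqF// nmz_gt0.
Qed.

End TangentLimits.

(** * Infinitesimal conditions at the base point in scaled form *)

Section InfinitesimalConditions.
Context {R : realType} {X : metricType R}.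
Variable p : X.

(** Clearing the denominator also covers [x = y = p], where a finite defect forces [z = p]. The sum
    replaces the maximum because its scaled limit is immediate. *)
Lemma midpoint_defect_lt (x y z : X) (e : R) : 0 < e ->
  (midpoint_defect p x y z < e%:E)%E ->
  `|mdist x z - mdist x y / 2| <= e * (mdist x p + mdist y p).
Proof.
rewrite /midpoint_defect => e0; have dx := mdist_ge0 x p.
have dy := mdist_ge0 y p.
case: ifPn => [/andP[/eqP-> /eqP->]|].
  case: ifPn => [/eqP-> _|]; last by rewrite ltNge leey.
  by rewrite mdistxx mul0r subr0 normr0 addr0 mulr0.
rewrite negb_and -!mdist_gt0 => xy0.
have m0 : 0 < Num.max (mdist x p) (mdist y p) by rewrite lt_max.
rewrite lte_fin ltr_pdivrMr// => /ltW/le_trans; apply.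
by rewrite ler_pM2l// ge_max lerDl lerDr dx dy.
Qed.

Lemma midpoint_scaled_cvg (r : normalizing_seq R) (x y z : nat -> X) :
  mutually_stable r x y -> mutually_stable r x (cst p) ->
  mutually_stable r y (cst p) ->
  midpoint_defect p (x n) (y n) (z n) @[n --> \oo] --> 0%E ->
  scaled_dist r x z @ \oo --> stable_dist r x y / 2.
Proof.
move=> xy xp yp def0; apply/cvgrPdist_lt => e e0.
set S := stable_dist r x (cst p) + stable_dist r y (cst p).
have S0 : 0 <= S by rewrite addr_ge0// stable_dist_ge0.
(* Eventually the scaled sum of distances to [p] is below [S + 1], so this tolerance costs at most
   [e / 2]; moreover [S + 1] cannot vanish. *)
have e'0 : 0 < e / 2 / (S + 1) by rewrite !divr_gt0// ltr_wpDl.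
have e20 : 0 < e / 2 by rewrite divr_gt0.
have e'E : (0 < (e / 2 / (S + 1))%:E)%E by rewrite lte_fin.
have := def0 _ (open_ereal_lt' e'E); rewrite near_simpl => defn.
near=> n.
have xyn : `|stable_dist r x y - scaled_dist r x y n| < e.
  by near: n; have /cvgrPdist_lt := xy; apply.
have Sn : scaled_dist r x (cst p) n + scaled_dist r y (cst p) n < S + 1.
  near: n; apply: (cvgr_lt S); last by rewrite ltrDl.
  exact: cvgD xp yp.
have : (midpoint_defect p (x n) (y n) (z n) < (e / 2 / (S + 1))%:E)%E.
  by near: n.
move=> /(midpoint_defect_lt e'0) dn.
have {dn} : `|scaled_dist r x z n - scaled_dist r x y n / 2| <= e / 2.
  have rn := nmz_gt0 r n.
  have -> : scaled_dist r x z n - scaled_dist r x y n / 2 =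
      (mdist (x n) (z n) - mdist (x n) (y n) / 2) / r n.
    by rewrite /scaled_dist; ring.
  rewrite normrM normfV (gtr0_norm rn) ler_pdivrMr//; apply: le_trans dn _.
  have -> : mdist (x n) p + mdist (y n) p =
      (scaled_dist r x (cst p) n + scaled_dist r y (cst p) n) * r n.
    by rewrite /scaled_dist -mulrDl divfK// gt_eqF.
  have S1 : S + 1 != 0 by rewrite gt_eqF// ltr_wpDl.
  by rewrite mulrA ler_pM2r// -[leRHS](divfK S1) ler_pM2l// ltW.
by move: xyn; rewrite !ltr_norml ler_norml; lra.
Unshelve. all: by end_near. Qed.

Lemma liminf_A2_near : (0 <= liminf_A2 p)%E -> forall e, 0 < e ->
  \forall q \near (p, p, p, p), - e <= A2 p q.1.1.1 q.1.1.2 q.1.2 q.2.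
Proof.
rewrite /liminf_A2 limf_einfE => inf0 e e0.
have /ereal_sup_gt[_ [U pU <-]] : ((- e)%:E <
    ereal_sup [set ereal_inf ((fun q : X * X * X * X =>
     (A2 p q.1.1.1 q.1.1.2 q.1.2 q.2)%:E) @` V) | V in nbhs (p, p, p, p)])%E.
  by apply: lt_le_trans inf0; rewrite lte_fin oppr_lt0.
move=> infU; apply: filterS pU => q Uq; rewrite -lee_fin ltW//.
by apply: lt_le_trans infU _; apply: ereal_inf_lbound; exists q.
Qed.

Lemma A2_numerator (w x y z : X) (e : R) : 0 <= e -> - e <= A2 p w x y z ->
  3^-1 * (mdist x y ^+ 2 + mdist y z ^+ 2 + mdist z x ^+ 2) <=
  mdist w x ^+ 2 + mdist w y ^+ 2 + mdist w z ^+ 2 +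
  e * (mdist w p + mdist x p + mdist y p + mdist z p) ^+ 2.
Proof.
rewrite /A2 => e0; case: ifPn => [/and4P[/eqP-> /eqP-> /eqP-> /eqP->] _|nall].
  by rewrite mdistxx expr0n/= !addr0 expr0n/= !mulr0.
set m := Num.max _ _; set S := (X in e * X ^+ 2).
have [w0 x0 y0 z0] : [/\ 0 <= mdist w p, 0 <= mdist x p, 0 <= mdist y p &
  0 <= mdist z p] by split; exact: mdist_ge0.
have m0 : 0 < m.
  by rewrite !lt_max !mdist_gt0 -orbA -!negb_and.
have mS : m ^+ 2 <= S ^+ 2.
  rewrite ler_sqr ?nnegrE ?(ltW m0)//; last by rewrite /S; lra.
  by rewrite /m !ge_max /S; lra.
rewrite ler_pdivlMr ?exprn_gt0//.
by move: (ler_wpM2l e0 mS); lra.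
Qed.

End InfinitesimalConditions.

Section TangentGeometry.
Context {R : realType} {X : metricType R} {p : X} {r : normalizing_seq R}.
Variable F : pretangent_family p r.

Lemma pretangent_midpoint : midpoint_convex_at p -> tangent F ->
  separable (pretangent F) ->
  forall u v : pretangent F, exists m, midpoint m u v.
Proof.
move=> hmid tan sep u v; pose x := val (repr u); pose y := val (repr v).
pose o : F := SigSub (mem_set (pfam_base F)).
have [z [xyz yxz]] := hmid x y (pfam_cvg_base _) (pfam_cvg_base _).
have xz : scaled_dist r x z @ \oo --> mdist u v / 2.
  by apply: midpoint_scaled_cvg xyz;
    [exact: pfam_stable|exact: (pfam_stable (b := o))..].
have yz : scaled_dist r y z @ \oo --> mdist u v / 2.
  rewrite metric_sym; apply: midpoint_scaled_cvg yxz;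
    [exact: pfam_stable|exact: (pfam_stable (b := o))..].
(* Scaled distances to [z] need not converge for every member, but the detour through [x] bounds
   them. *)
have zub (a : F) : has_ubound (range (scaled_dist r (val a) z)).
  have ax := pfam_stable (a := a) (b := repr u).
  have c : cvgn (fun n => scaled_dist r (val a) x n + scaled_dist r x z n).
    by apply: is_cvgD => //; apply/cvg_ex; eexists; exact: xz.
  have [B BP] := bounded_fun_has_ubound (cvg_seq_bounded c).
  exists B => _ [n _ <-]; apply: le_trans (scaled_dist_triangle _ x _ _ _) _.
  by apply: BP; exists n.
have [m [nk [nkS mP]]] := tangent_limit_point tan sep zub.
have nkoo := strictly_increasing_cvg nkS.
exists m; split.
  rewrite -(cvg_lim _ (mP u))//; apply: cvg_lim => //.
  exact: cvg_comp nkoo xz.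
rewrite -(cvg_lim _ (mP v))//; apply: cvg_lim => //.
exact: cvg_comp nkoo yz.
Qed.

Lemma pretangent_three_point : (0 <= liminf_A2 p)%E ->
  three_point_inequality (M := pretangent F).
Proof.
move=> /liminf_A2_near A2p u v1 v2 v3.
pose o : F := SigSub (mem_set (pfam_base F)).
pose s (a b : F) n := scaled_dist r (val a) (val b) n.
have sc a b : s a b @ \oo --> stable_dist r (val a) (val b).
  exact: pfam_stable.
have s2 a b : s a b n ^+ 2 @[n --> \oo] --> stable_dist r (val a) (val b) ^+ 2.
  rewrite expr2; under eq_fun do rewrite expr2.
  exact: (cvgM (sc a b) (sc a b)).
set T := (leLHS); set Q := (leRHS).
set w := repr u; set x := repr v1; set y := repr v2; set z := repr v3.
pose S := stable_dist r (val w) (val o) + stable_dist r (val x) (val o) +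
  stable_dist r (val y) (val o) + stable_dist r (val z) (val o).
(* The error term of [A2_numerator], divided by the square of [r n], tends to [e * S ^+ 2], where
   [S] does not depend on [e]. *)
have key e : 0 < e -> T <= Q + e * S ^+ 2.
  move=> e0.
  have sS : (s w o n + s x o n + s y o n + s z o n) @[n --> \oo] --> S.
    by do !apply: cvgD => //; exact: sc.
  have sQ : (s w x n ^+ 2 + s w y n ^+ 2 + s w z n ^+ 2 +
      e * (s w o n + s x o n + s y o n + s z o n) ^+ 2) @[n --> \oo] -->
      Q + e * S ^+ 2.
    apply: cvgD; first by apply: cvgD; [apply: cvgD|]; exact: s2.
    apply: cvgMr; rewrite expr2; under eq_fun do rewrite expr2.
    exact: (cvgM sS sS).
  have sT : 3^-1 * (s x y n ^+ 2 + s y z n ^+ 2 + s z x n ^+ 2)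
      @[n --> \oo] --> T.
    by apply: cvgMr; apply: cvgD; [apply: cvgD|]; exact: s2.
  have := ler_cvg_to sT sQ; apply.
  have wxyz : (val w n, val x n, val y n, val z n) @[n --> \oo] -->
      (p, p, p, p).
    exact: (cvg_pair (cvg_pair (cvg_pair (pfam_cvg_base w) (pfam_cvg_base x))
      (pfam_cvg_base y)) (pfam_cvg_base z)).
  have A2n : \forall n \near \oo,
      - e <= A2 p (val w n) (val x n) (val y n) (val z n).
    exact: wxyz _ (A2p e e0).
  apply: filterS A2n => n /(A2_numerator (ltW e0)).
  have rn := nmz_gt0 r n; have rn2 : 0 < (r n) ^- 2.
    by rewrite invr_gt0 exprn_gt0.
  rewrite -(ler_pM2r rn2) /s /scaled_dist/= -!mulrDl !expr_div_n; lra.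
apply/ler_addgt0Pr => e e0.
have S10 : 0 < S ^+ 2 + 1 by rewrite ltr_wpDl ?sqr_ge0.
have := key _ (divr_gt0 e0 S10); move=> /le_trans; apply.
by rewrite lerD2l mulrAC ler_pdivrMr// ler_pM2l// lerDl.
Qed.

End TangentGeometry.

Theorem mainTheorem3 (R : realType) (X : metricType R) (p : X)
    (hmid : midpoint_convex_at p)
    (hA2 : (0 <= liminf_A2 p)%E)
    (r : normalizing_seq R) (F : pretangent_family p r)
    (htan : tangent F) (hsep : separable (pretangent F)) :
  nonneg_curved_aleksandrov (pretangent F).
Proof.
have geo : geodesic_space (pretangent F).
  apply: complete_midpoints_geodesic; first exact: pretangent_complete.
  exact: pretangent_midpoint.
split=> //; apply: three_point_not_thinner geo.
exact: pretangent_three_point.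
Qed.
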